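(* Let $\mathbb{F}$ be an algebraically closed field of characteristic $0$. Suppose that $(\mathcal{N},\circ)$ is an infinite-dimensional simple Novikov algebra over $\mathbb{F}$ containing an element $e$ such that: (i) $e$ is left locally finite, i.e. the left multiplication operator $L_e:v\mapsto e\circ v$ is locally finite; (ii) the right multiplication operator $R_e:v\mapsto v\circ e$ is a constant map, i.e. $R_e=b\,\mathrm{Id}_{\mathcal{N}}$ for some $b\in\mathbb{F}$; (iii) if $R_e=0$, then $L_e$ is surjective. Then there exist an additive subgroup $\Delta$ of $\mathbb{F}$, an extension field $\mathbb{F}_1$ of $\mathbb{F}$, a symmetric two-cycle $f\in c^2(\Delta,\mathbb{F}_1^{\times})$, $J\in\{\{0\},\mathbb{N}\}$ and $\xi\in\mathbb{F}$ such that $(\mathcal{N},\circ)$ is isomorphic, as an algebra over $\mathbb{F}$, to $(\mathcal{A}(\Delta,f,J),\circ_{\xi})$.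
   Context: $\mathbb{N}$ denotes the nonnegative integers. A Novikov algebra over $\mathbb{F}$ is an $\mathbb{F}$-vector space $\mathcal{N}$ with a bilinear operation $\circ$ such that for all $u,v,w\in\mathcal{N}$: $(u\circ v)\circ w=(u\circ w)\circ v$ and $(u\circ v)\circ w-u\circ(v\circ w)=(v\circ u)\circ w-v\circ(u\circ w)$. An ideal is a subspace $\mathcal{I}$ with $\mathcal{N}\circ\mathcal{I}\subset\mathcal{I}$ and $\mathcal{I}\circ\mathcal{N}\subset\mathcal{I}$. $\mathcal{N}$ is simple if its only ideals are $\{0\}$ and $\mathcal{N}$, and $\mathcal{N}\circ\mathcal{N}\neq\{0\}$. A linear transformation $T$ of a vector space $V$ is locally finite if for every $v\in V$ the subspace $\sum_{m=0}^{\infty}\mathbb{F}T^m(v)$ is finite-dimensional. For a group $G$ (here $G=\Delta$, written additively) and a field $\mathbb{F}_1$, with $\mathbb{F}_1^{\times}=\mathbb{F}_1\setminus\{0\}$, a two-cycle is a map $f:G\times G\to\mathbb{F}_1^{\times}$ with $f(g_1,g_2)f(g_1g_2,g_3)=f(g_1,g_2g_3)f(g_2,g_3)$ for all $g_1,g_2,g_3\in G$; the set of two-cycles is denoted $c^2(G,\mathbb{F}_1^{\times})$. A two-cycle is symmetric if $f(g_1,g_2)=f(g_2,g_1)$ for all $g_1,g_2$. Let $\Delta$ be an additive subgroup of $\mathbb{F}$, $\mathbb{F}_1$ an extension field of $\mathbb{F}$, $f\in c^2(\Delta,\mathbb{F}_1^{\times})$ symmetric and $J\in\{\{0\},\mathbb{N}\}$.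 $\mathcal{A}(\Delta,f,J)$ is the $\mathbb{F}_1$-vector space with basis $\{u_{\alpha,j}\mid(\alpha,j)\in\Delta\times J\}$ and the commutative associative $\mathbb{F}_1$-bilinear product $u_{\alpha_1,j_1}\cdot u_{\alpha_2,j_2}=f(\alpha_1,\alpha_2)u_{\alpha_1+\alpha_2,j_1+j_2}$. Let $\partial$ be the $\mathbb{F}_1$-linear map with $\partial(u_{\alpha,j})=\alpha u_{\alpha,j}+j u_{\alpha,j-1}$ (the last term being $0$ when $j=0$). For $\xi\in\mathbb{F}$, the operation $\circ_\xi$ on $\mathcal{A}(\Delta,f,J)$, viewed as a vector space over $\mathbb{F}$, is $u\circ_{\xi}v=u\cdot\partial(v)+\xi\,(u\cdot v)$. *)

(* Defs.v *)
From HB Require Import structures.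
From mathcomp Require Import all_boot all_order all_algebra.
From mathcomp Require Import finmap.
From mathcomp Require Import monalg.

Set Implicit Arguments.
Unset Strict Implicit.
Unset Printing Implicit Defensive.

Import GRing.Theory.
Local Open Scope ring_scope.

Section LinearNotions.
Variables (F : fieldType) (V : lmodType F).

Definition lin_span (S : V -> Prop) (w : V) : Prop :=
  exists (n : nat) (c : 'I_n -> F) (x : 'I_n -> V),
    (forall i, S (x i)) /\ w = \sum_(i < n) c i *: x i.

Definition finite_dim (W : V -> Prop) : Prop :=
  exists s : seq V, forall w, W w <-> lin_span (fun x => x \in s) w.

Definition infinite_dimensional : Prop := ~ finite_dim (fun=> True).

Definition locally_finite (T : V -> V) : Prop :=
  forall v, finite_dim (lin_span (fun w => exists m : nat, w = iter m T v)).

End LinearNotions.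

Section Novikov.
Variables (F : fieldType) (N : lmodType F) (op : N -> N -> N).

Definition novikov : Prop :=
  (forall u v w, op (op u v) w = op (op u w) v) /\
  (forall u v w,
     op (op u v) w - op u (op v w) = op (op v u) w - op v (op u w)).

Definition algebra_ideal (I : {pred N}) : Prop :=
  submod_closed I /\
  (forall u v, v \in I -> op u v \in I /\ op v u \in I).

Definition simple_algebra : Prop :=
  (forall I : {pred N}, algebra_ideal I -> I =i pred1 0 \/ I =i predT) /\
  (exists u v, op u v != 0).

End Novikov.

Section TwoCycles.
Variables (G : zmodType) (K : fieldType) (f : G -> G -> K).

Definition two_cycle : Prop :=
  (forall a b, f a b != 0) /\
  (forall a b c, f a b * f (a + b) c = f a (b + c) * f b c).

Definition symmetric_cycle : Prop := forall a b, f a b = f b a.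

End TwoCycles.

Section SubgroupType.
Variables (V : zmodType) (Delta : zmodClosed V).

Record subgroup := Subgroup { subgroup_val : V; _ : subgroup_val \in Delta }.

HB.instance Definition _ := [isSub for subgroup_val].
HB.instance Definition _ := [Choice of subgroup by <:].
HB.instance Definition _ := [SubChoice_isSubZmodule of subgroup by <:].

End SubgroupType.

Section AlgebraA.
Variables (F F1 : fieldType) (iota : {rmorphism F -> F1}).
Variables (Delta : zmodClosed F).
Variables (f : subgroup Delta -> subgroup Delta -> F1) (J : {pred nat}).

(* The free F1-module on Delta * J: u@_k is the coefficient of u at k and
   << k >> is the basis vector indexed by k. *)
Definition algA : lmodType F1 :=
  {malg F1[(subgroup Delta * {j : nat | j \in J})%type]}.

(* u_(alpha, j), with junk value 0 when j is not in J. The junk value is never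
   used below if J = {0} or J = nat. *)
Definition ubas (alpha : subgroup Delta) (j : nat) : algA :=
  if insub j is Some j' then << (alpha, j') >> else 0.

Definition algA_mul (u v : algA) : algA :=
  \sum_(k <- msupp u) \sum_(l <- msupp v)
    (u@_k * v@_l * f k.1 l.1) *: ubas (k.1 + l.1) (val k.2 + val l.2).

(* For j = 0 the term j u_(alpha, j - 1) vanishes because its coefficient does. *)
Definition algA_der (u : algA) : algA :=
  \sum_(k <- msupp u)
    u@_k *: (iota (val k.1) *: ubas k.1 (val k.2)
             + (val k.2)%:R *: ubas k.1 (val k.2).-1).

Definition algA_op (xi : F) (u v : algA) : algA :=
  algA_mul u (algA_der v) + iota xi *: algA_mul u v.

(* Isomorphism of F-algebras onto (A(Delta, f, J), o_xi), on which F acts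
   through iota. *)
Definition isomorphic_to_algA (xi : F) (N : lmodType F) (op : N -> N -> N) :
    Prop :=
  exists phi : N -> algA,
    [/\ bijective phi,
        forall u v, phi (u + v) = phi u + phi v,
        forall (c : F) u, phi (c *: u) = iota c *: phi u
      & forall u v, phi (op u v) = algA_op xi (phi u) (phi v)].

End AlgebraA.

(* Main.v *)
Require Import Defs.
From HB Require Import structures.
From mathcomp Require Import all_boot all_order all_algebra.
From mathcomp Require Import finmap monalg boolp ring.

(* Right multiplications commute with each other, and left multiplications
   normalise the commutative algebra R which they generate; L_e - b is a
   derivation d of the Novikov product. If R e = N, then r |-> r e identifies N
   with R, so N is a commutative algebra with unit e, u o v = u (d v + b v), and
   N is d-simple. In a d-simple algebra with d locally finite, eigenvectors of d
   are units, ker d is a field F1, and together with an element t such that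
   d t = 1, if there is one, the eigenvectors generate everything over F1.
   If R e <> N, then b <> 0 and L_e has a kernel. The ideal generated by
   N o ker L_e has only eigenvalues -k b, k > 0, for L_e, so it misses e and
   vanishes. Hence N o v = 0 for any v <> 0 in ker L_e, which forces R v = N.
   Moreover L_v is locally nilpotent: otherwise L_e has an eigenvector y with
   eigenvalue outside b nat, and the ideal generated by all L_v^k y lies in R e.
   So the first case applies to v, with b = 0. *)

Set Implicit Arguments.
Unset Strict Implicit.
Unset Printing Implicit Defensive.

Import GRing.Theory.
Local Open Scope ring_scope.

(** * Products of operators [T - a], generalised eigenspaces and the Fitting decomposition *)

Section LinearOperator.
Variables (K : fieldType) (V : lmodType K) (T : {linear V -> V}).

(** The product of the [T - a] for [a] in [s], applied to [x]. Local finiteness over an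
    algebraically closed field is used in the form [kill s x = 0] for some [s]. *)
Fixpoint kill (s : seq K) (x : V) : V :=
  if s is a :: s' then kill s' (T x - a *: x) else x.

Lemma kill0 s : kill s 0 = 0.
Proof. by elim: s => //= a s IHs; rewrite linear0 scaler0 subr0. Qed.

Lemma killP s (c : K) x y : kill s (c *: x + y) = c *: kill s x + kill s y.
Proof.
elim: s x y => //= a s IHs x y; rewrite -IHs; congr (kill s _).
by rewrite linearP !scalerDr scalerN !scalerA (mulrC a) opprD addrACA.
Qed.

Lemma killD s x y : kill s (x + y) = kill s x + kill s y.
Proof. by have := killP s 1 x y; rewrite !scale1r. Qed.

Lemma killZ s c x : kill s (c *: x) = c *: kill s x.
Proof. by have := killP s c x 0; rewrite kill0 !addr0. Qed.

Lemma killB s x y : kill s (x - y) = kill s x - kill s y.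
Proof. by rewrite -[- y]scaleN1r killD killZ scaleN1r. Qed.

Lemma kill_cat s1 s2 x : kill (s1 ++ s2) x = kill s2 (kill s1 x).
Proof. by elim: s1 x => /=. Qed.

Lemma kill_comm s x : T (kill s x) = kill s (T x).
Proof. by elim: s x => //= a s IHs x; rewrite IHs linearB linearZ. Qed.

Lemma killC s1 s2 x : kill s1 (kill s2 x) = kill s2 (kill s1 x).
Proof.
elim: s1 x => //= a s1 IHs x; rewrite -IHs; congr (kill s1 _).
by rewrite kill_comm killB killZ.
Qed.

Lemma kill_eigen s a x : T x = a *: x -> kill s x = (\prod_(b <- s) (a - b)) *: x.
Proof.
move=> Tx; elim: s => [|b s IHs] /=; first by rewrite big_nil scale1r.
by rewrite big_cons Tx -scalerBl killZ IHs scalerA.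
Qed.

Lemma kill_eigenvector s x : kill s x = 0 -> x != 0 ->
  exists2 a, a \in s & exists2 y, y != 0 & T y = a *: y.
Proof.
elim: s x => [|a s IHs] x /=; first by move=> -> /eqP.
move=> kx nz; have [/eqP|nz'] := eqVneq (T x - a *: x) 0.
  by rewrite subr_eq0 => /eqP Tx; exists a; [rewrite mem_head | exists x].
have [b bs [y ny Ty]] := IHs _ kx nz'.
by exists b; [rewrite inE bs orbT | exists y].
Qed.

Lemma kill_nseq0 n x : kill (nseq n 0) x = iter n T x.
Proof.
by elim: n x => // n IHn x; rewrite /= IHn scale0r subr0 -iterSr.
Qed.

(** For such [x], every eigenvector of [T] in the cyclic span of [x] has its eigenvalue in [P]. *)
Definition spectrum_in (P : K -> Prop) (x : V) : Prop :=
  exists2 s, (forall a, a \in s -> P a) & kill s x = 0.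

Lemma spectrum_in0 P : spectrum_in P 0.
Proof. by exists nil. Qed.

Lemma spectrum_inD P x y : spectrum_in P x -> spectrum_in P y -> spectrum_in P (x + y).
Proof.
move=> [s Ps kx] [s' Ps' ky]; exists (s ++ s').
  by move=> a; rewrite mem_cat => /orP[/Ps|/Ps'].
by rewrite killD kill_cat kx kill0 add0r kill_cat killC ky kill0.
Qed.

Lemma spectrum_inZ P c x : spectrum_in P x -> spectrum_in P (c *: x).
Proof. by move=> [s Ps kx]; exists s => //; rewrite killZ kx scaler0. Qed.

Lemma spectrum_in_eigen P a x :
  spectrum_in P x -> T x = a *: x -> ~ P a -> x = 0.
Proof.
move=> [s Ps kx] Tx nPa; move: kx; rewrite (kill_eigen s Tx) => /eqP.
rewrite scaler_eq0 => /orP[|/eqP //]; rewrite prodf_seq_eq0 => /hasP[b bs].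
by rewrite /= subr_eq0 => /eqP ab; case: nPa; rewrite ab; apply: Ps.
Qed.

Inductive gensum : V -> Prop :=
| Gensum0 : gensum 0
| GensumD n a x y : kill (nseq n a) x = 0 -> gensum y -> gensum (x + y).

(** On the generalised eigenspaces for [b != a] the operator [T - a] is onto, so a sum of
    generalised eigenvectors lies in its range up to the component for [a]. *)
Lemma gensum_solve a y : gensum y ->
  exists2 z, gensum z & exists n, kill (nseq n a) (y - (T z - a *: z)) = 0.
Proof.
elim=> [|n b x {}y kx _ [z gz [m kz]]].
  by exists 0; [exact: Gensum0 | exists 0%N; rewrite /= linear0 scaler0 !subr0].
have [eba|nba] := eqVneq b a.
  exists z => //; exists (n + m)%N.
  rewrite eba in kx; rewrite -addrA nseqD kill_cat killD kx add0r.
  by rewrite killC kz kill0.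
have [w Tw kw] : exists2 w, T w - a *: w = x & kill (nseq n b) w = 0.
  elim: n x kx => [|n IHn] x /= kx; first by exists 0; rewrite // kx linear0 scaler0 subr0.
  have [w Tw kw] := IHn _ kx.
  have ba : b - a != 0 by rewrite subr_eq0.
  (* From [(T - a) w = (T - b) x] follows [(T - a) (x - w) = (b - a) x]. *)
  exists ((b - a)^-1 *: (x - w)).
    rewrite linearZ /= scalerA mulrC -scalerA -scalerBr; apply: (scalerI ba).
    rewrite scalerA divff // scale1r linearB scalerBr /=.
    have -> : T x = (T w - a *: w) + b *: x by rewrite Tw subrK.
    rewrite scalerBl -[T w - _ + _]addrA [T w + _ - _]addrAC subrr add0r.
    by rewrite opprB addrACA addNr add0r.
  have e1 u : kill (nseq n b) (T u - b *: u) = T (kill (nseq n b) u) - b *: kill (nseq n b) u.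
    by rewrite killB killZ kill_comm.
  rewrite e1 killZ killB kw subr0.
  by rewrite linearZ /= scalerA mulrC -scalerA -scalerBr -e1 kx scaler0.
exists (w + z); first exact: GensumD kw gz.
exists m; suff -> : x + y - (T (w + z) - a *: (w + z)) = y - (T z - a *: z) by [].
rewrite -Tw linearD scalerDr [in X in _ - X]opprD [in X in _ - X]addrACA.
by rewrite opprD addrACA subrr add0r.
Qed.

(** Induction on [s]: the vector [(T - a) x] is such a sum, hence equals [(T - a) z] up to a
    generalised eigenvector for [a], and then [x - z] is itself one, with exponent one higher. *)
Lemma kill_gensum s x : kill s x = 0 -> gensum x.
Proof.
elim: s x => [|a s IHs] x /=; first by move=> ->; exact: Gensum0.
move=> /IHs /(gensum_solve a)[z gz [n kn]].
rewrite -[x](subrK z); apply: (@GensumD n.+1 a) => //=.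
rewrite -{}kn linearB /=; congr (kill _ _).
by rewrite scalerBr !opprD !opprK addrACA.
Qed.

Lemma kill_nseq_range n a x : a != 0 -> kill (nseq n a) x = 0 -> exists y, T y = x.
Proof.
move=> a0; elim: n x => [|n IHn] x /= kx; first by exists 0; rewrite linear0.
have [y Ty] := IHn _ kx.
exists (a^-1 *: (x - y)); rewrite linearZ linearB /= Ty.
by rewrite opprB addrC subrK scalerA mulVf ?scale1r.
Qed.

(** Generalised eigenvectors for [a != 0] lie in the range of [T]; those for 0 are killed by a power
    of [T]. *)
Lemma fitting_decomposition s x : kill s x = 0 ->
  exists z n, iter n T (x - T z) = 0.
Proof.
move=> /kill_gensum; elim=> [|n a {}x y kx _ [z [m km]]].
  by exists 0, 0%N; rewrite /= linear0 subr0.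
have [a0|a0] := eqVneq a 0.
  exists z, (n + m)%N; rewrite -kill_nseq0 nseqD kill_cat -addrA killD -a0 kx add0r.
  by rewrite killC a0 !kill_nseq0 km -kill_nseq0 kill0.
have [w Tw] := kill_nseq_range a0 kx.
by exists (w + z), m; rewrite linearD Tw opprD addrACA subrr add0r.
Qed.

Lemma injective_range s x : (forall y, T y = 0 -> y = 0) -> kill s x = 0 ->
  exists y, T y = x.
Proof.
move=> injT /fitting_decomposition[z [n]] kz; exists z; apply/esym/eqP.
rewrite -subr_eq0; apply/eqP; elim: n kz => [//|n IHn] /= kz.
exact/IHn/injT.
Qed.

End LinearOperator.

(** * Local finiteness over an algebraically closed field *)

Section LocallyFinite.
Variables (F : closedFieldType) (V : lmodType F) (T : {linear V -> V}).

(** The vector [p(T) x]. *)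
Let ev (p : {poly F}) (x : V) : V := \sum_(i < size p) p`_i *: iter i T x.

Let evE n (p : {poly F}) x : (size p <= n)%N ->
  ev p x = \sum_(i < n) p`_i *: iter i T x.
Proof.
move=> pn; rewrite /ev (big_ord_widen n (fun i => p`_i *: iter i T x)) //.
rewrite big_mkcond; apply: eq_bigr => i _; case: ltnP => // le_p_i.
by rewrite nth_default ?scale0r.
Qed.

Let ev_XsubC p a x : ev (('X - a%:P) * p) x = ev p (T x - a *: x).
Proof.
have sz : (size (('X - a%:P) * p)%R <= (size p).+1)%N.
  by rewrite (leq_trans (size_polyMleq _ _)) // size_XsubC addnC /= addn2.
rewrite (evE _ sz) /ev.
under eq_bigr => i _ do rewrite mulrBl coefB coefCM coefXM scalerBl.
rewrite sumrB big_ord_recl /= scale0r add0r.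
rewrite [X in _ - X]big_ord_recr /= [p`_(size p)]nth_default // mulr0 scale0r addr0.
rewrite -sumrB; apply: eq_bigr => i _.
have Tl j u : iter j T (T u - a *: u) = iter j T (T u) - a *: iter j T u.
  by elim: j => //= j ->; rewrite linearB linearZ.
by rewrite Tl scalerBr scalerA (mulrC a) -iterSr.
Qed.

(** The first [n + 1] iterates of [x] lie in the span of [n] vectors. A linear relation among them
    is a polynomial [p != 0] with [p(T) x = 0], and the roots of [p] form the list. *)
Lemma locally_finite_kill : locally_finite T -> forall x, exists s, kill T s x = 0.
Proof.
move=> lfT x; have [s sP] := lfT x.
pose n := size s.
have row i : exists a : 'I_n -> F, iter i T x = \sum_(j < n) a j *: s`_j.
  have /sP[m [c [y [ys ->]]]] : lin_span (fun w => exists m, w = iter m T x) (iter i T x).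
    exists 1%N, (fun=> 1), (fun=> iter i T x).
    by split; [move=> _; exists i | rewrite big_ord1 scale1r].
  (* The [y k] may repeat, so their coefficients are collected at the first position of each in
     [s]. *)
  exists (fun j : 'I_n => \sum_(k < m | index (y k) s == j :> nat) c k).
  under [RHS]eq_bigr => j _ do rewrite scaler_suml.
  rewrite (exchange_big_dep predT) //=; apply: eq_bigr => k _.
  have lt : (index (y k) s < n)%N by rewrite index_mem.
  by rewrite (big_pred1 (Ordinal lt)) /= ?nth_index // => j; rewrite -val_eqE eq_sym.
have [M defM] : exists M : 'M[F]_(n.+1, n),
    forall i : 'I_n.+1, iter i T x = \sum_(j < n) M i j *: s`_j.
  have /fin_all_exists[a aP] : forall i : 'I_n.+1, exists a : {ffun 'I_n -> F},
      iter i T x = \sum_(j < n) a j *: s`_j.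
    move=> i; have [a aP] := row i; exists (finfun a); rewrite aP.
    by apply: eq_bigr => j _; rewrite ffunE.
  by exists (\matrix_(i, j) a i j) => i; rewrite aP; apply: eq_bigr => j _; rewrite mxE.
have /rowV0Pn[v /sub_kermxP vM v0] : kermx M != 0.
  rewrite kermx_eq0 /row_free neq_ltn ltnS rank_leq_col //.
pose p := \poly_(i < n.+1) v 0 (inord i).
have p0 : p != 0.
  have /rV0Pn[i vi] := v0.
  apply: contra vi => /eqP pe; have := congr1 (fun q : {poly F} => q`_i) pe.
  by rewrite coef_poly ltn_ord inord_val coef0 => ->.
have evp : ev p x = 0.
  rewrite (evE (n := n.+1)) ?size_poly //.
  under eq_bigr => i _ do rewrite coef_poly ltn_ord inord_val defM scaler_sumr.
  rewrite exchange_big big1 //= => j _.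
  under eq_bigr => i _ do rewrite scalerA.
  rewrite -scaler_suml; have := congr1 (fun w : 'rV__ => w 0 j) vM.
  by rewrite !mxE => ->; rewrite scale0r.
have [r pr] := closed_field_poly_normal p.
have lc : lead_coef p != 0 by rewrite lead_coef_eq0.
exists r; move: evp; rewrite pr.
have evZ c q y : c != 0 -> ev (c *: q) y = c *: ev q y.
  move=> c0; rewrite /ev size_scale // scaler_sumr; apply: eq_bigr => i _.
  by rewrite coefZ scalerA.
rewrite evZ // => /eqP; rewrite scaler_eq0 (negbTE lc) /= => /eqP.
elim: r x {p lc pr v0 vM v M defM row sP n p0 evZ s} => [|a r IHr] x.
  by rewrite big_nil /= /ev size_poly1 big_ord1 coef1 scale1r.
by rewrite big_cons ev_XsubC; apply: IHr.
Qed.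

End LocallyFinite.

(** * Additive maps on the free module, defined by sums over supports *)

Section AdditiveExtension.
Variables (K : choiceType) (G : zmodType).

Lemma malg_ind (P : {malg G[K]} -> Prop) :
  P 0 -> (forall c k, P << c *g k >>) ->
  (forall g1 g2, P g1 -> P g2 -> P (g1 + g2)) -> forall g, P g.
Proof.
by move=> P0 PU PD g; rewrite (monalgE g); apply: big_ind => // k _; apply: PU.
Qed.

Variables (V : zmodType) (h : K -> G -> V).
Hypothesis hD : forall k x y, h k (x + y) = h k x + h k y.

Let h0 k : h k 0 = 0.
Proof. by apply: (addrI (h k 0)); rewrite -hD !addr0. Qed.

Lemma sum_msuppEw (D : {fset K}) (g : {malg G[K]}) : (msupp g `<=` D)%fset ->
  \sum_(k <- msupp g) h k g@_k = \sum_(k <- D) h k g@_k.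
Proof.
move=> le; rewrite [LHS](big_fset_incl _ le) => //= x xd /mcoeff_outdom ->.
exact: h0.
Qed.

Lemma sum_msuppD (g1 g2 : {malg G[K]}) :
  \sum_(k <- msupp (g1 + g2)) h k (g1 + g2)@_k =
  \sum_(k <- msupp g1) h k g1@_k + \sum_(k <- msupp g2) h k g2@_k.
Proof.
rewrite !(@sum_msuppEw (msupp g1 `|` msupp g2)%fset) ?msuppD_le ?fsubsetUl ?fsubsetUr //.
by rewrite -big_split; apply: eq_bigr => k _; rewrite mcoeffD hD.
Qed.

Lemma sum_msuppU c k : \sum_(l <- msupp << c *g k >>) h l << c *g k >>@_l = h k c.
Proof. by rewrite (sum_msuppEw msuppU_le) big_seq_fset1 mcoeffUU. Qed.

Lemma sum_msupp0 : \sum_(k <- msupp (0 : {malg G[K]})) h k (0 : {malg G[K]})@_k = 0.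
Proof. by rewrite msupp0 big_nil. Qed.

End AdditiveExtension.

(** * The product and the derivation of [algA] on basis vectors and coefficients *)

Section AlgebraAOperations.
Variables (F F1 : fieldType) (iota : {rmorphism F -> F1}) (Delta : zmodClosed F).
Variables (f : subgroup Delta -> subgroup Delta -> F1) (J : {pred nat}).

Local Notation A := (algA F1 Delta J).
Local Notation key := (subgroup Delta * {j : nat | j \in J})%type.
Local Notation der := (@algA_der F F1 iota Delta J).

Lemma algA_derD : {morph der : u v / u + v}.
Proof.
move=> u v.
exact: (sum_msuppD (h := fun k c => c *: (iota (val k.1) *: ubas F1 J k.1 (val k.2)
  + (val k.2)%:R *: ubas F1 J k.1 (val k.2).-1)) (fun k x y => scalerDl _ x y)).
Qed.

Lemma algA_derU c (k : key) : algA_der iota << c *g k >> =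
  c *: (iota (val k.1) *: ubas F1 J k.1 (val k.2)
        + (val k.2)%:R *: ubas F1 J k.1 (val k.2).-1).
Proof.
exact: (sum_msuppU (h := fun k c => c *: (iota (val k.1) *: ubas F1 J k.1 (val k.2)
  + (val k.2)%:R *: ubas F1 J k.1 (val k.2).-1)) (fun k x y => scalerDl _ x y)).
Qed.

Let mulD_inner (v : A) (k : key) x y :
  \sum_(l <- msupp v) ((x + y) * v@_l * f k.1 l.1) *: ubas F1 J (k.1 + l.1) (val k.2 + val l.2)
  = \sum_(l <- msupp v) (x * v@_l * f k.1 l.1) *: ubas F1 J (k.1 + l.1) (val k.2 + val l.2)
  + \sum_(l <- msupp v) (y * v@_l * f k.1 l.1) *: ubas F1 J (k.1 + l.1) (val k.2 + val l.2).
Proof. by rewrite -big_split; apply: eq_bigr => l _; rewrite !mulrDl scalerDl. Qed.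

Let mulD_outer c (k l : key) x y :
  (c * (x + y) * f k.1 l.1) *: ubas F1 J (k.1 + l.1) (val k.2 + val l.2)
  = (c * x * f k.1 l.1) *: ubas F1 J (k.1 + l.1) (val k.2 + val l.2)
  + (c * y * f k.1 l.1) *: ubas F1 J (k.1 + l.1) (val k.2 + val l.2).
Proof. by rewrite mulrDr mulrDl scalerDl. Qed.

Lemma algA_mulDl (v : A) : {morph (fun u => algA_mul f u v) : u1 u2 / u1 + u2}.
Proof.
move=> u1 u2.
exact: (sum_msuppD (h := fun k c => \sum_(l <- msupp v)
  (c * v@_l * f k.1 l.1) *: ubas F1 J (k.1 + l.1) (val k.2 + val l.2)) (mulD_inner v)).
Qed.

Lemma algA_mul0l (v : A) : algA_mul f 0 v = 0.
Proof. by rewrite /algA_mul msupp0 big_nil. Qed.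

Lemma algA_mulUl c k (v : A) : algA_mul f << c *g k >> v = \sum_(l <- msupp v)
  (c * v@_l * f k.1 l.1) *: ubas F1 J (k.1 + l.1) (val k.2 + val l.2).
Proof.
exact: (sum_msuppU (h := fun k c => \sum_(l <- msupp v)
  (c * v@_l * f k.1 l.1) *: ubas F1 J (k.1 + l.1) (val k.2 + val l.2)) (mulD_inner v)).
Qed.

Lemma algA_mulUD c k : {morph @algA_mul F F1 Delta f J << c *g k >> : v1 v2 / v1 + v2}.
Proof.
move=> v1 v2; rewrite !algA_mulUl.
exact: (sum_msuppD (h := fun l x =>
  (c * x * f k.1 l.1) *: ubas F1 J (k.1 + l.1) (val k.2 + val l.2)) (mulD_outer c k)).
Qed.

Lemma algA_mulU0 c k : @algA_mul F F1 Delta f J << c *g k >> 0 = 0.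
Proof. by rewrite algA_mulUl msupp0 big_nil. Qed.

Lemma algA_mulUU c k c' k' : @algA_mul F F1 Delta f J << c *g k >> << c' *g k' >> =
  (c * c' * f k.1 k'.1) *: ubas F1 J (k.1 + k'.1) (val k.2 + val k'.2).
Proof.
rewrite algA_mulUl.
exact: (sum_msuppU (h := fun l x =>
  (c * x * f k.1 l.1) *: ubas F1 J (k.1 + l.1) (val k.2 + val l.2)) (mulD_outer c k)).
Qed.

Lemma mcoeff_ubas a j (k : key) :
  (ubas F1 J a j : A)@_k = ((a == k.1) && (j == val k.2))%:R.
Proof.
rewrite /ubas; case: insubP => [j' _ jE|].
  by rewrite mcoeffU -jE /eq_op /= -val_eqE.
case: k => a' [i iJ] /= njJ; rewrite mcoeff0 [j == i](_ : _ = false) ?andbF //.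
by apply: contraNF njJ => /eqP ->.
Qed.

Lemma ubas_out (a : subgroup Delta) j : j \notin J -> ubas F1 J a j = 0.
Proof. by move=> njJ; rewrite /ubas insubN. Qed.

Lemma algA_der0 : der 0 = 0.
Proof. by rewrite /algA_der msupp0 big_nil. Qed.

(* Unfolding these makes the unifier diverge when rewriting in [algA]. *)
Opaque algA_der algA_mul ubas.

Let coefZ c (u : A) (k : key) : (c *: u)@_k = c * u@_k.
Proof. exact: mcoeffZ. Qed.

(* The coefficient of u_(a, j), with value 0 when j is not in J. *)
Definition acoef (u : A) a j : F1 := if insub j is Some j' then u@_(a, j') else 0.

Lemma acoefD a j : {morph (fun u => acoef u a j) : u v / u + v}.
Proof. by move=> u v; rewrite /acoef; case: insub => [j'|]; rewrite ?mcoeffD ?addr0. Qed.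

Lemma acoefU c (k : key) a j :
  acoef << c *g k >> a j = c *+ ((k.1 == a) && (val k.2 == j)).
Proof.
case: k => b i /=; rewrite /acoef; case: insubP => [j' _ jE|njJ].
  by rewrite mcoeffU -jE.
rewrite [val i == j](_ : _ = false) ?andbF //.
by apply: contraNF njJ => /eqP <-; exact: valP.
Qed.

Lemma mcoeff_der (u : A) (k : key) :
  (der u)@_k = iota (val k.1) * u@_k + acoef u k.1 (val k.2).+1 *+ (val k.2).+1.
Proof.
elim/malg_ind: u => [|c l|u v IHu IHv].
- rewrite algA_der0 !mcoeff0 mulr0 add0r /acoef.
  by case: insub => [?|]; rewrite ?mcoeff0 mul0rn.
- rewrite algA_derU acoefU mcoeffZ mcoeffD.
  rewrite [X in _ * (X + _)]coefZ [X in _ * (_ + X)]coefZ 2!mcoeff_ubas mcoeffU.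
  case: l k => a [j jJ] [b [i iJ]] /=.
  have -> : ((a, exist _ j jJ) == (b, exist _ i iJ) :> key) = ((a == b) && (j == i)).
    by rewrite /eq_op /= -val_eqE.
  case: eqVneq => [->|] /=; last by rewrite !(mulr0, mul0rn, mulr0n, addr0).
  rewrite mulrDr; congr (_ + _).
    by case: eqP => _; rewrite !(mulr1, mulr0, mulr0n, mulr1n) // mulrC.
  case: j jJ => [|j] jJ /=; first by rewrite mul0r mulr0 mulr0n mul0rn.
  by rewrite eqSS; case: eqP => [->|]; rewrite !(mulr1, mulr0, mulr0n, mul0rn, mulr1n) // mulr_natr.
rewrite algA_derD [LHS]mcoeffD [X in X + _ = _]IHu [X in _ + X = _]IHv.
by rewrite [X in _ = iota _ * X + _]mcoeffD acoefD mulrDr mulrnDl addrACA.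
Qed.

Lemma acoef_bound (u : A) : exists n, forall a j, (n <= j)%N -> acoef u a j = 0.
Proof.
elim/malg_ind: u => [|c l|u v [n Hn] [m Hm]].
- by exists 0%N => a j _; rewrite /acoef; case: insub => [?|] //; rewrite mcoeff0.
- exists (val l.2).+1 => a j lj; rewrite acoefU (ltn_eqF lj) andbF //.
by exists (maxn n m) => a j; rewrite geq_max => /andP[/Hn nj /Hm mj]; rewrite acoefD nj mj addr0.
Qed.

Lemma mcoeff_acoef (u : A) (k : key) : u@_k = acoef u k.1 (val k.2).
Proof. by case: k => a j; rewrite /acoef /= valK. Qed.

Lemma algA_UE c (k : key) : << c *g k >> = c *: ubas F1 J k.1 (val k.2) :> A.
Proof.
apply/malgP => l; rewrite [RHS]mcoeffZ mcoeff_ubas mcoeffU.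
case: k l => a [i iJ] [b [j jJ]] /=.
by rewrite mulr_natr.
Qed.

Lemma algA_derZ c : {morph der : u / c *: u >-> c *: u}.
Proof.
elim/malg_ind => [|c' k|u v IHu IHv].
- by rewrite scaler0 algA_der0 scaler0.
- have E : c *: << c' *g k >> = << c * c' *g k >> :> A.
    by rewrite (algA_UE c' k) (algA_UE _ k) scalerA.
  apply: (etrans (congr1 der E)).
  apply: (etrans (algA_derU (c * c') k)).
  rewrite -scalerA.
  congr (_ *: _).
  exact: (esym (algA_derU c' k)).
rewrite scalerDr; apply: (etrans (algA_derD _ _)).
apply: (etrans (f_equal2 +%R IHu IHv)); rewrite -scalerDr; congr (_ *: _).
exact: (esym (algA_derD u v)).
Qed.

HB.instance Definition _ := GRing.isZmodMorphism.Build A A der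
  (fun u v => etrans (algA_derD u (- v))
    (congr1 (+%R (der u)) (etrans (congr1 der (esym (scaleN1r v)))
       (etrans (algA_derZ (-1) v) (scaleN1r _))))).
HB.instance Definition _ := GRing.isScalable.Build F1 A A *:%R der
  algA_derZ.

Lemma algA_der_ubas a j : j \in J ->
  der (ubas F1 J a j) = iota (val a) *: ubas F1 J a j + j%:R *: ubas F1 J a j.-1.
Proof.
move=> jJ; pose k : key := (a, exist (fun j => j \in J) j jJ).
have -> : ubas F1 J a j = << 1 *g k >> by rewrite (algA_UE 1 k) scale1r.
apply: (etrans (algA_derU 1 k)).
by rewrite scale1r (algA_UE 1 k) scale1r.
Qed.

(** For [j] in [J], each factor sends u_(a, j) to [j] times u_(a, j - 1), so [j + 1] factors reach
    0. *)
Lemma kill_ubas a j c : kill der (nseq j.+1 (iota (val a))) (c *: ubas F1 J a j) = 0.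
Proof.
elim: j c => [|j IHj] c; last have [jJ|njJ] := boolP (j.+1 \in J).
- rewrite /= linearZ /= scalerA mulrC -scalerA -scalerBr.
  have [jJ|njJ] := boolP (0%N \in J); last first.
    by rewrite ubas_out // linear0 scaler0 subr0 scaler0.
  by rewrite algA_der_ubas // scale0r addr0 subrr scaler0.
- have E : der (c *: ubas F1 J a j.+1) - iota (val a) *: (c *: ubas F1 J a j.+1)
      = (c * j.+1%:R) *: ubas F1 J a j.
    have derx := algA_der_ubas a jJ; set x := ubas F1 J a j.+1 in derx *.
    rewrite [der _]algA_derZ [_ *: (_ *: x)]scalerA [_ * c]mulrC.
    rewrite -[(c * iota _) *: x]scalerA -[_ - _]scalerBr derx.
    rewrite [X in _ *: X]addrAC subrr add0r.
    exact: scalerA.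
  exact: (etrans (congr1 (kill der (nseq j.+1 (iota (val a)))) E) (IHj _)).
by rewrite ubas_out // scaler0 kill0.
Qed.

Lemma algA_der_kill (u : A) : exists s, kill der s u = 0.
Proof.
elim/malg_ind: u => [|c k|u v [s ks] [s' ks']].
- by exists nil.
- by exists (nseq (val k.2).+1 (iota (val k.1))); rewrite algA_UE kill_ubas.
exists (s ++ s'); rewrite killD kill_cat ks kill0 add0r.
by rewrite kill_cat killC ks' kill0.
Qed.

Hypothesis J_pred : forall j, j.+1 \in J -> j \in J.
Hypothesis charF1 : forall n, (n.+1%:R != 0 :> F1).

(** Comparing coefficients gives [(iota a - c) u_(a, j) + (j + 1) u_(a, j + 1) = 0]. If
    [iota a != c], the coefficients vanish by descent from a large [j]; if [iota a = c], those of
    positive index vanish in characteristic 0. *)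
Lemma algA_der_eigen (u : A) c : algA_der iota u = c *: u ->
  forall k, u@_k != 0 -> iota (val k.1) = c /\ val k.2 = 0%N.
Proof.
move=> Du.
have E k : iota (val k.1) * u@_k + acoef u k.1 (val k.2).+1 *+ (val k.2).+1 = c * u@_k.
  by rewrite -mcoeff_der Du mcoeffZ.
have E1 a : iota (val a) != c -> forall j, acoef u a j = 0.
  move=> ac j.
  have [n Hn] : exists n, forall j, (n <= j)%N -> acoef u a j = 0.
    by have [n Hn] := acoef_bound u; exists n; exact: Hn.
  elim: n Hn => [|n IHn] Hn; first exact: Hn.
  apply: IHn => i; rewrite leq_eqVlt => /orP[/eqP <-|]; last exact: Hn.
  case nJ: (n \in J); last by rewrite /acoef insubF.
  have := E (a, exist _ n nJ); rewrite mcoeff_acoef /= (Hn n.+1) // mul0rn addr0.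
  by move/eqP; rewrite -subr_eq0 -mulrBl mulf_eq0 subr_eq0 (negbTE ac) => /eqP.
move=> k uk.
have kc : iota (val k.1) = c.
  by apply/eqP; apply: contraNT uk => /E1 kc; rewrite mcoeff_acoef kc.
split=> //; case: k kc uk => a [[//|j] jJ] /= kc.
have := E (a, exist _ j (J_pred jJ)); rewrite /= kc => /eqP.
rewrite -[X in _ == X]addr0 (inj_eq (addrI _)) -mulr_natr mulf_eq0 (negbTE (charF1 j)) orbF.
by rewrite mcoeff_acoef /= => ->.
Qed.

End AlgebraAOperations.

(** * Differentially simple commutative algebras: constants, eigenvectors and the two-cycle *)

Section DifferentialRing.
Variables (F : closedFieldType) (A : comAlgType F) (d : {linear A -> A}).

Definition constant_pred : {pred A} := [pred x | d x == 0].

Record differentially_simple : Prop := DifferentiallySimple {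
  derM : forall x y, d (x * y) = d x * y + x * d y;
  der_simple : forall I : A -> Prop,
    I 0 -> (forall x y, I x -> I y -> I (x + y)) ->
    (forall a x, I x -> I (a * x)) -> (forall x, I x -> I (d x)) ->
    (exists2 x, x != 0 & I x) -> I 1
}.

Hypothesis dsimple : differentially_simple.
Let dM := derM dsimple.

Lemma der1 : d 1 = 0.
Proof.
have /eqP := dM 1 1; rewrite !mulr1 mul1r -[X in X == _]addr0.
by rewrite (inj_eq (addrI _)) eq_sym => /eqP.
Qed.

Fact constant_subring : subring_closed constant_pred.
Proof.
split=> [|x y|x y]; rewrite !inE ?der1 // => /eqP dx /eqP dy.
  by rewrite linearB dx dy subrr.
by rewrite dM dx dy mul0r mulr0 addr0.
Qed.
HB.instance Definition _ := GRing.isSubringClosed.Build A constant_pred constant_subring.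

(** The constants of [d] form the extension field [F1]. *)
Record der_constant := DerConstant {constant_val : A; _ : constant_val \in constant_pred}.
HB.instance Definition _ := [isSub for constant_val].
HB.instance Definition _ := [Choice of der_constant by <:].
HB.instance Definition _ := [SubChoice_isSubComNzRing of der_constant by <:].

Let dconst (c : der_constant) : d (val c) = 0.
Proof. by apply/eqP; exact: (valP c). Qed.

(** The ideal [x A] is stable under [d], so it contains 1; differentiating [x y = 1] gives the
    eigenvalue of [y]. *)
Lemma eigenvector_inv a x : x != 0 -> d x = a *: x ->
  exists2 y, x * y = 1 & d y = - a *: y.
Proof.
move=> x0 dx.
have [y xy] : exists y, 1 = x * y.
  apply: (der_simple dsimple (I := fun z => exists y, z = x * y)).
  - by exists 0; rewrite mulr0.
  - by move=> _ _ [y ->] [z ->]; exists (y + z); rewrite mulrDr.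
  - by move=> b _ [y ->]; exists (b * y); rewrite mulrCA.
  - by move=> _ [y ->]; exists (a *: y + d y); rewrite dM dx mulrDr -scalerAl scalerAr.
  by exists x => //; exists 1; rewrite mulr1.
exists y => //.
have := dM x y; rewrite -xy der1 dx -scalerAl -xy => /esym/eqP.
rewrite addrC addr_eq0 => /eqP xdy.
have := congr1 (fun z => y * z) xdy.
by rewrite mulrA (mulrC y) -xy mul1r mulrN -scalerAr mulr1 scaleNr.
Qed.

Fact constant_inv_ex (c : der_constant) : c != 0 -> exists c', c' * c = 1.
Proof.
move=> c0; have v0 : val c != 0 by [].
have [|y cy dy] := @eigenvector_inv 0 _ v0; first by rewrite dconst scale0r.
have yc : y \in constant_pred by rewrite inE dy oppr0 scale0r.
by exists (DerConstant yc); apply: val_inj; rewrite /= mulrC.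
Qed.

Definition constant_inv (c : der_constant) : der_constant :=
  if pselect (exists c', c' * c = 1) is left h then sval (cid h) else 0.

Fact constant_mulVf c : c != 0 -> constant_inv c * c = 1.
Proof.
by move=> /constant_inv_ex h; rewrite /constant_inv; case: pselect => // h'; case: cid.
Qed.

Fact constant_inv0 : constant_inv 0 = 0.
Proof.
rewrite /constant_inv; case: pselect => // h; have [c /eqP] := h.
by rewrite mulr0 eq_sym oner_eq0.
Qed.
HB.instance Definition _ :=
  GRing.ComNzRing_isField.Build der_constant constant_mulVf constant_inv0.

Fact constant_scale1 (a : F) : a%:A \in constant_pred.
Proof. by rewrite inE linearZ /= der1 scaler0. Qed.

Definition scalar_constant (a : F) : der_constant := DerConstant (constant_scale1 a).

Fact scalar_constant_is_zmod_morphism : zmod_morphism scalar_constant.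
Proof. by move=> a b; apply: val_inj; rewrite /= scalerBl. Qed.
Fact scalar_constant_is_monoid_morphism : monoid_morphism scalar_constant.
Proof.
split=> [|a b]; apply: val_inj; rewrite /= ?scale1r //.
by rewrite -scalerAl mul1r scalerA.
Qed.
HB.instance Definition _ := GRing.isZmodMorphism.Build F der_constant scalar_constant
  scalar_constant_is_zmod_morphism.
HB.instance Definition _ := GRing.isMonoidMorphism.Build F der_constant scalar_constant
  scalar_constant_is_monoid_morphism.

(** These become the group [Delta]: a quotient of eigenvectors realises the difference of their
    eigenvalues. *)
Definition eigenvalues : {pred F} := [pred a | `[< exists2 x, x != 0 & d x = a *: x >]].

Fact eigenvalues_zmod_closed : zmod_closed eigenvalues.
Proof.
split=> [|a b /asboolP[x x0 dx] /asboolP[y y0 dy]]; apply/asboolP.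
  by exists 1; rewrite ?oner_neq0 // der1 scale0r.
have [z yz dz] := eigenvector_inv y0 dy.
exists (x * z); last by rewrite dM dx dz -scalerAl -scalerAr -scalerDl.
apply: contraNneq x0 => xz0; apply/eqP.
by rewrite -[x]mulr1 -yz mulrCA xz0 mulr0.
Qed.
HB.instance Definition _ := GRing.isZmodClosed.Build F eigenvalues eigenvalues_zmod_closed.

Definition eigenvalue_group : zmodClosed F := eigenvalues.

Fact eigenvector_pair (a : subgroup eigenvalue_group) :
  exists p : A * A, [/\ p.1 * p.2 = 1, d p.1 = val a *: p.1 & d p.2 = - val a *: p.2].
Proof.
have /asboolP[x x0 dx] := valP a; have [y xy dy] := eigenvector_inv x0 dx.
by exists (x, y).
Qed.

(** A chosen eigenvector [u a] and its inverse [v a]; the choice need not be multiplicative in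
    [a]. *)
Let u a := (sval (cid (eigenvector_pair a))).1.
Let v a := (sval (cid (eigenvector_pair a))).2.
Let uv a : u a * v a = 1.
Proof. by rewrite /u /v; case: cid => p []. Qed.
Let du a : d (u a) = val a *: u a.
Proof. by rewrite /u; case: cid => p []. Qed.
Let dv a : d (v a) = - val a *: v a.
Proof. by rewrite /v; case: cid => p []. Qed.

Fact cocycle_const a b : u a * u b * v (a + b) \in constant_pred.
Proof.
rewrite inE !dM !du dv -scalerAl -scalerAr -scalerDl -scalerAl -scalerAr -scalerDl.
by rewrite subrr scale0r.
Qed.

(** The defect of multiplicativity of [u]: [u a * u b = cocycle a b * u (a + b)]. *)
Definition cocycle a b : der_constant := DerConstant (cocycle_const a b).

Lemma cocycle_two_cycle : two_cycle cocycle.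
Proof.
split=> [a b|a b c]; last first.
  apply: val_inj => /=.
  (* Both sides of the cocycle identity reduce to [u a * u b * u c * v (a + b + c)]. *)
  have -> : u a * u b * v (a + b) * (u (a + b) * u c * v (a + b + c))
     = u a * u b * u c * v (a + b + c) * (u (a + b) * v (a + b)) by ring.
  have -> : u a * u (b + c) * v (a + (b + c)) * (u b * u c * v (b + c))
     = u a * u b * u c * v (a + (b + c)) * (u (b + c) * v (b + c)) by ring.
  by rewrite !uv addrA.
apply: contra_neq (oner_neq0 A) => /(congr1 val) /= f0.
have -> : (1 : A) = u a * v a * (u b * v b) * (u (a + b) * v (a + b)) by rewrite !uv !mulr1.
have -> : u a * v a * (u b * v b) * (u (a + b) * v (a + b))
  = u a * u b * v (a + b) * (v a * v b * u (a + b)) by ring.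
by rewrite f0 mul0r.
Qed.

Lemma cocycle_symmetric : symmetric_cycle cocycle.
Proof. by move=> a b; apply: val_inj; rewrite /= [u a * u b]mulrC [a + b]addrC. Qed.

(** * The isomorphism with [algA], for given [J] and [t] *)

Section Basis.
(** Two cases are covered: [d t = 1] with [J] all of nat, and [t = 0] with [J = {0}], where only
    [t ^+ 0 = 1] occurs. By [J_max], a Jordan block of size 2 of [d] for the eigenvalue 0 makes [J]
    full. *)
Variables (J : {pred nat}) (t : A).
Hypothesis charF0 : [pchar F] =i pred0.
Hypothesis d_lf : forall x, exists s, kill d s x = 0.
Hypothesis J0 : 0%N \in J.
Hypothesis J_add : forall i j, i \in J -> j \in J -> (i + j)%N \in J.
Hypothesis J_pred : forall j, j.+1 \in J -> j \in J.
Hypothesis dt : forall j, j \in J -> d (t ^+ j) = t ^+ j.-1 *+ j.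
Hypothesis J_max : forall x, d x != 0 -> d (d x) = 0 -> forall j, j \in J.

Local Notation algA := (algA der_constant eigenvalue_group J).
Local Notation key := (subgroup eigenvalue_group * {j : nat | j \in J})%type.
Local Notation ubas := (ubas der_constant J).

Let coef_term (k : key) (c : der_constant) : A := val c * (u k.1 * t ^+ val k.2).

(** The inverse of the required isomorphism; it sends u_(a, j) to [u a * t ^+ j]. *)
Definition algA_eval (g : algA) : A := \sum_(k <- msupp g) coef_term k g@_k.

Let coef_termD (k : key) x y : coef_term k (x + y) = coef_term k x + coef_term k y.
Proof. by rewrite /coef_term raddfD /= mulrDl. Qed.

Lemma algA_eval0 : algA_eval 0 = 0.
Proof. exact: sum_msupp0. Qed.

Lemma algA_evalD : {morph algA_eval : x y / x + y}.
Proof. by move=> x y; apply: (sum_msuppD coef_termD). Qed.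

Lemma algA_evalU c (k : key) : algA_eval << c *g k >> = val c * (u k.1 * t ^+ val k.2).
Proof. exact: (sum_msuppU coef_termD). Qed.

Opaque algA_eval.

Lemma algA_evalZ c g : algA_eval (c *: g) = val c * algA_eval g.
Proof.
elim/malg_ind: g => [|c' k|g1 g2 IH1 IH2].
- by rewrite scaler0 algA_eval0 mulr0.
- have E : c *: (<< c' *g k >> : algA) = << c * c' *g k >>.
    by rewrite (algA_UE c' k) (algA_UE (c * c') k) scalerA.
  apply: (etrans (congr1 algA_eval E)).
  apply: (etrans (algA_evalU (c * c') k)).
  apply: (etrans (esym (mulrA _ _ _))).
  congr (_ * _).
  exact: (esym (algA_evalU c' k)).
rewrite scalerDr; apply: (etrans (algA_evalD _ _)).
apply: (etrans (f_equal2 +%R IH1 IH2)); rewrite -mulrDr; congr (_ * _).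
exact: (esym (algA_evalD g1 g2)).
Qed.

Lemma algA_eval_ubas a j : j \in J -> algA_eval (ubas a j) = u a * t ^+ j.
Proof.
move=> jJ; pose k : key := (a, exist (fun j => j \in J) j jJ).
have E : ubas a j = << 1 *g k >> by rewrite (algA_UE 1 k) scale1r.
apply: (etrans (congr1 algA_eval E)); apply: (etrans (algA_evalU 1 k)).
exact: mul1r.
Qed.

Lemma algA_eval_der g : algA_eval (algA_der scalar_constant g) = d (algA_eval g).
Proof.
elim/malg_ind: g => [|c k|g1 g2 IH1 IH2].
- apply: (etrans (congr1 algA_eval (algA_der0 scalar_constant eigenvalue_group J))).
  exact: (etrans algA_eval0 (esym (etrans (congr1 d algA_eval0) (linear0 d)))).
- apply: (etrans (congr1 algA_eval (algA_derU scalar_constant c k))).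
  apply: (etrans (algA_evalZ _ _)).
  rewrite (congr1 d (algA_evalU c k)).
  rewrite [algA_eval _]algA_evalD.
  rewrite [X in _ * (X + _)]algA_evalZ [X in _ * (_ + X)]algA_evalZ.
  rewrite dM dconst mul0r add0r; congr (_ * _).
  case: k => a [j jJ] /=; rewrite dM du dt // (algA_eval_ubas _ jJ) algA_eval_ubas; last first.
    by case: j jJ => // j /J_pred.
  rewrite -scalerAl mul1r scalerAl; congr (_ + _).
  have valn n : val (n%:R : der_constant) = n%:R.
    by elim: n => // n IHn; rewrite !mulrS -IHn.
  by rewrite [constant_val _]valn mulr_natl mulrnAr.
apply: (etrans (congr1 algA_eval (algA_derD scalar_constant g1 g2))).
apply: (etrans (algA_evalD _ _)); apply: (etrans (f_equal2 +%R IH1 IH2)).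
by rewrite -linearD; congr (d _); exact: (esym (algA_evalD g1 g2)).
Qed.

Lemma algA_eval_mul g h : algA_eval (algA_mul cocycle g h) = algA_eval g * algA_eval h.
Proof.
elim/malg_ind: g => [|c k|g1 g2 IH1 IH2].
- apply: (etrans (congr1 algA_eval (algA_mul0l _ _))).
  exact: (etrans algA_eval0 (esym (etrans (congr1 ( *%R^~ _) algA_eval0) (mul0r _)))).
- elim/malg_ind: h => [|c' k'|h1 h2 IH1 IH2].
  + apply: (etrans (congr1 algA_eval (algA_mulU0 _ _ _))).
    exact: (etrans algA_eval0 (esym (etrans (congr1 ( *%R _) algA_eval0) (mulr0 _)))).
  + apply: (etrans (congr1 algA_eval (algA_mulUU _ _ _ _ _))).
    have kk' : (val k.2 + val k'.2)%N \in J by rewrite J_add ?(valP k.2) ?(valP k'.2).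
    apply: (etrans (etrans (algA_evalZ _ _) (congr1 ( *%R _) (algA_eval_ubas _ kk')))).
    apply: (etrans _ (esym (f_equal2 *%R (algA_evalU c k) (algA_evalU c' k')))).
    rewrite exprD; set p := t ^+ _; set q := t ^+ _; set s := (k.1 + k'.1).
    transitivity (val c * val c' * (u k.1 * u k'.1 * v s) * (u s * (p * q))); first by [].
    transitivity (val c * val c' * (u k.1 * u k'.1) * (p * q) * (u s * v s)); first by ring.
    by rewrite uv mulr1; ring.
  apply: (etrans (congr1 algA_eval (algA_mulUD _ _ _ _ _))).
  apply: (etrans (algA_evalD _ _)); apply: (etrans (f_equal2 +%R IH1 IH2)).
  by rewrite -mulrDr; congr (_ * _); exact: (esym (algA_evalD h1 h2)).
apply: (etrans (congr1 algA_eval (algA_mulDl _ _ _ _))).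
apply: (etrans (algA_evalD _ _)); apply: (etrans (f_equal2 +%R IH1 IH2)).
by rewrite -mulrDl; congr (_ * _); exact: (esym (algA_evalD g1 g2)).
Qed.

Let nat_neq0 n : n.+1%:R != 0 :> F.
Proof. by have /pcharf0P -> := charF0. Qed.

Let const_nat_neq0 n : n.+1%:R != 0 :> der_constant.
Proof. by rewrite -(rmorph_nat scalar_constant) fmorph_eq0. Qed.

Let iter_der_monomial (c : A) n : n \in J -> d c = 0 -> iter n d (c * t ^+ n) = c *+ n`!.
Proof.
elim: n c => [|n IHn] c nJ dc; first exact: mulr1.
rewrite iterSr [d _]dM dc mul0r add0r (dt nJ) mulrnAr -mulrnAl IHn.
- by rewrite factS mulrnA.
- exact: J_pred.
by rewrite raddfMn /= dc mul0rn.
Qed.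

(** Taylor expansion in [t]: if [d^(n+1) x = 0], then [d^n x] is constant, and subtracting
    [(d^n x / n!) t^n] lowers the order. *)
Let algA_eval_onto_unipotent a n x : iter n d x = 0 -> exists g, algA_eval g = u a * x.
Proof.
elim: n x => [|n IHn] x /= nx; first by exists 0; rewrite algA_eval0 nx mulr0.
have [/IHn//|x0] := eqVneq (iter n d x) 0.
have nJ : n \in J.
  (* For [n > 0], [J_max] applies to [d^(n-1) x]. *)
  by case: n x0 nx {IHn} => // n x0 nx; apply: J_max x0 nx _.
have fact_unit : n`!%:R != 0 :> F by rewrite -(prednK (fact_gt0 n)).
have cc : (n`!%:R : F)^-1 *: iter n d x \in constant_pred.
  by rewrite inE linearZ /= nx scaler0.
have [|g gx] := IHn (x - val (DerConstant cc) * t ^+ n).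
  have iterB m y z : iter m d (y - z) = iter m d y - iter m d z.
    by elim: m => //= m ->; rewrite linearB.
  rewrite iterB iter_der_monomial ?dconst //= -scaler_nat scalerA mulfV //.
  by rewrite scale1r subrr.
exists (g + << DerConstant cc *g (a, exist _ n nJ) >>).
by rewrite algA_evalD gx algA_evalU /= mulrBr mulrCA subrK.
Qed.

Lemma algA_eval_onto x : exists g, algA_eval g = x.
Proof.
have [s] := d_lf x; move=> /kill_gensum.
elim=> [|n a {}x y kx _ [g gy]]; first by exists 0; rewrite algA_eval0.
suff [h hx] : exists h, algA_eval h = x by exists (h + g); rewrite algA_evalD hx gy.
have [->|x0] := eqVneq x 0; first by exists 0; rewrite algA_eval0.
have aD : a \in eigenvalue_group.
  have [b] := kill_eigenvector kx x0; rewrite mem_nseq => /andP[_ /eqP ->] [z z0 dz].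
  by apply/asboolP; exists z.
pose al : subgroup eigenvalue_group := Subgroup aD.
(* Multiplication by the inverse of [u al] shifts the eigenvalue [a] to 0. *)
have shift m z : iter m d (v al * z) = v al * kill d (nseq m a) z.
  elim: m z => //= m IHm z; rewrite -IHm -iterS iterSr; congr (iter m d _).
  by rewrite dM dv /= mulrBr -scalerAl -scalerAr scaleNr addrC.
have [|h hx] := @algA_eval_onto_unipotent al n (v al * x); first by rewrite shift kx mulr0.
by exists h; rewrite hx mulrA uv mul1r.
Qed.

Lemma scalar_constant_inj (a b : subgroup eigenvalue_group) :
  scalar_constant (val a) = scalar_constant (val b) -> a = b.
Proof. by move=> /fmorph_inj /val_inj. Qed.

(** The kernel of [algA_eval] is stable under the derivation, so induction on the killing list
    leaves an eigenvector. It has a single term [c u_(a, 0)], and [c * u a = 0] forces [c = 0]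
    because [u a] is a unit. *)
Lemma algA_eval_inj0 g : algA_eval g = 0 -> g = 0.
Proof.
have [s] := algA_der_kill scalar_constant g.
elim: s g => [|c s IHs] g; first by [].
move=> /IHs kg pg.
have /kg/eqP : algA_eval (algA_der scalar_constant g - c *: g) = 0.
  by rewrite -scaleNr algA_evalD algA_evalZ pg mulr0 addr0 algA_eval_der pg linear0.
rewrite subr_eq0 => /eqP Dg.
have E := algA_der_eigen J_pred const_nat_neq0 Dg.
apply/malgP => k; rewrite mcoeff0; apply/eqP; apply: contraT => gk.
have [kc k0] := E k gk.
have gE : g = << g@_k *g k >>.
  apply/malgP => l; rewrite mcoeffU; case: eqVneq => [->//|nkl].
  rewrite mulr0n; apply/eqP; apply: contraT => gl.
  have [lc l0] := E l gl.
  have kl1 : k.1 = l.1 by apply: scalar_constant_inj; rewrite kc lc.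
  have kl2 : k.2 = l.2 by apply: val_inj; rewrite k0 l0.
  by move: nkl; rewrite (surjective_pairing k) kl1 kl2 -surjective_pairing eqxx.
move: pg; rewrite gE algA_evalU k0 expr0 mulr1 => pg.
have := congr1 ( *%R^~ (v k.1)) pg.
rewrite -mulrA uv mulr1 mul0r => gk0.
by move: gk; rewrite -(inj_eq val_inj) gk0 eqxx.
Qed.

Lemma differential_classification (xi : F) (op : A -> A -> A) :
  (forall x y, op x y = x * (d y + xi *: y)) ->
  isomorphic_to_algA scalar_constant cocycle J xi op.
Proof.
move=> opE.
have algA_eval_inj : injective algA_eval.
  move=> g h gh; apply/eqP; rewrite -subr_eq0; apply/eqP; apply: algA_eval_inj0.
  by rewrite -scaleN1r algA_evalD algA_evalZ gh rmorphN1 mulN1r subrr.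
pose phi x := sval (cid (algA_eval_onto x)).
have phiK : cancel phi algA_eval by move=> x; rewrite /phi; case: cid.
have algA_evalK : cancel algA_eval phi by move=> g; apply: algA_eval_inj; rewrite phiK.
exists phi; split.
- by exists algA_eval.
- by move=> x y; apply: algA_eval_inj; rewrite algA_evalD !phiK.
- by move=> c x; apply: algA_eval_inj; rewrite algA_evalZ !phiK /= -scalerAl mul1r.
move=> x y; apply: algA_eval_inj; rewrite phiK opE.
apply/esym; apply: (etrans (algA_evalD _ _)).
have e1 := algA_eval_mul (phi x) (algA_der scalar_constant (phi y)).
have e2 := etrans (algA_evalZ (scalar_constant xi) _)
  (congr1 ( *%R (val (scalar_constant xi))) (algA_eval_mul (phi x) (phi y))).
apply: (etrans (f_equal2 +%R e1 e2)).
by rewrite algA_eval_der !phiK mulrDr /= -scalerAl mul1r scalerAr.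
Qed.

End Basis.
End DifferentialRing.

(** * Classification of differentially simple algebras with locally finite derivation *)

Definition isomorphic_to_some_algA (F : closedFieldType) (N : lmodType F)
    (op : N -> N -> N) : Prop :=
  exists (Delta : zmodClosed F) (F1 : fieldType) (iota : {rmorphism F -> F1})
         (f : subgroup Delta -> subgroup Delta -> F1) (J : {pred nat}) (xi : F),
    [/\ two_cycle f, symmetric_cycle f,
        J =i pred1 0%N \/ J =i predT
      & isomorphic_to_algA iota f J xi op].

Theorem differentially_simple_classification (F : closedFieldType)
    (A : comAlgType F) (d : {linear A -> A}) (xi : F) (op : A -> A -> A) :
  [pchar F] =i pred0 -> differentially_simple d ->
  (forall x, exists s, kill d s x = 0) ->
  (forall x y, op x y = x * (d y + xi *: y)) ->
  isomorphic_to_some_algA op.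
Proof.
move=> charF0 ds d_lf opE.
exists (eigenvalue_group ds), (der_constant d), (scalar_constant ds), (@cocycle _ _ _ ds).
have [[x dx ddx]|no_t] := pselect (exists2 x, d x != 0 & d (d x) = 0).
  have [|y xy] := eigenvector_inv ds (a := 0) dx; first by rewrite scale0r.
  rewrite oppr0 scale0r => dy.
  (* Here [y] is the inverse of the constant [d x], so [t = x * y] has derivative 1. *)
  have dt : d (x * y) = 1 by rewrite (derM ds) dy mulr0 addr0.
  exists (fun=> true), xi; split;
    [exact: cocycle_two_cycle | exact: cocycle_symmetric | by right |].
  apply: (@differential_classification _ _ _ ds _ (x * y)) => // j _.
  elim: j => [|j IHj]; first exact: (der1 ds).
  rewrite exprS (derM ds) dt mul1r IHj mulrnAr mulrS; congr (_ + _).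
  by case: j {IHj} => // j; rewrite -exprS.
(* Without such an [x], take [J = {0}] and [t = 0]. *)
exists (fun j => j == 0%N), xi; split;
  [exact: cocycle_two_cycle | exact: cocycle_symmetric | by left |].
apply: (@differential_classification _ _ _ ds _ 0) => //.
- by move=> i j /eqP -> /eqP ->.
- by move=> j /eqP ->; exact: (der1 ds).
by move=> x dx ddx; case: no_t; exists x.
Qed.

(** * The algebra [R] of right multiplications of a simple Novikov algebra *)

Section RightMultiplications.
Variables (F : closedFieldType) (N : lmodType F) (op : {bilinear N -> N -> N}).
Hypotheses (novikov_op : novikov op) (simple_op : simple_algebra op).

Let op_rcomm u v w : op (op u v) w = op (op u w) v.
Proof. exact: (proj1 novikov_op). Qed.

Lemma novikov_swap u v w : op u (op v w) = op (op u v) w - op (op v u) w + op v (op u w).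
Proof.
have := proj2 novikov_op u v w => /eqP; rewrite subr_eq => /eqP ->.
set x := op (op v u) w; set y := op v (op u w); set z := op u (op v w).
by rewrite (addrAC (x - y)) (addrAC x) subrr add0r addrAC addNr add0r.
Qed.

Lemma simple_ideal (I : N -> Prop) :
  I 0 -> (forall x y, I x -> I y -> I (x + y)) -> (forall c x, I x -> I (c *: x)) ->
  (forall u x, I x -> I (op u x)) -> (forall u x, I x -> I (op x u)) ->
  (exists2 x, x != 0 & I x) -> forall x, I x.
Proof.
move=> I0 ID IZ IL IR [x x0 Ix] y.
have [|I1|I1] := (proj1 simple_op) [pred z | `[< I z >]].
- split; [split|] => [||u v].
  + exact/asboolP.
  + move=> c u v /asboolP Iu /asboolP Iv; apply/asboolP; exact/ID/Iv/IZ.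
  + by move=> /asboolP Iv; split; apply/asboolP; [apply: IL | apply: IR].
- have := I1 x; rewrite !inE (negbTE x0) => /asboolP; by case.
by have := I1 y; rewrite !inE => /asboolP.
Qed.

(** The commutative algebra [R] generated by the right multiplications, given inductively so that
    its properties follow by induction on how an operator is built. *)
Inductive right_op : (N -> N) -> Prop :=
| RightId : right_op (fun x => x)
| RightAdd r s : right_op r -> right_op s -> right_op (fun x => r x + s x)
| RightScale c r : right_op r -> right_op (fun x => c *: r x)
| RightMul r w : right_op r -> right_op (fun x => op (r x) w).

Lemma right_opP r c x y : right_op r -> r (c *: x + y) = c *: r x + r y.
Proof.
move=> rr; elim: rr => //= {r} [r s _ IHr _ IHs|a r _ IHr|r w _ IHr].
- by rewrite IHr IHs scalerDr addrACA.
- by rewrite IHr scalerDr !scalerA mulrC.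
by rewrite IHr linearPl.
Qed.

Lemma right_opD r x y : right_op r -> r (x + y) = r x + r y.
Proof. by move=> rr; have := right_opP 1 x y rr; rewrite !scale1r. Qed.

Lemma right_op0 r : right_op r -> r 0 = 0.
Proof. by move=> rr; apply: (addrI (r 0)); rewrite -right_opD // !addr0. Qed.

Lemma right_opZ r c x : right_op r -> r (c *: x) = c *: r x.
Proof. by move=> rr; rewrite -[c *: x]addr0 right_opP // right_op0 // addr0. Qed.

Lemma right_op_mul r x w : right_op r -> r (op x w) = op (r x) w.
Proof.
move=> rr; elim: rr => //= {r} [r s _ IHr _ IHs|a r _ IHr|r v _ IHr].
- by rewrite IHr IHs linearDl.
- by rewrite IHr linearZl_LR.
by rewrite IHr op_rcomm.
Qed.

Lemma right_opC r s x : right_op r -> right_op s -> r (s x) = s (r x).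
Proof.
move=> rr rs; elim: rs => //= {s} [s s' _ IHs _ IHs'|a s _ IHs|s v _ IHs].
- by rewrite right_opD // IHs IHs'.
- by rewrite right_opZ // IHs.
by rewrite right_op_mul // IHs.
Qed.

Lemma right_op_comp r s : right_op r -> right_op s -> right_op (fun x => r (s x)).
Proof.
move=> rr rs; elim: rr => //= {r} [r s' _ IHr _ IHs|a r _ IHr|r v _ IHr].
- exact: RightAdd IHr IHs.
- exact: RightScale IHr.
exact: RightMul IHr.
Qed.

(** Left-symmetry gives [[L_u, R_w] = R_(u o w) - R_w R_u], which lies in [R], and bracketing with
    [L_u] is a derivation on products. *)
Lemma right_op_commutator r u : right_op r ->
  exists2 r', right_op r' & forall x, op u (r x) = r (op u x) + r' x.
Proof.
move=> rr; elim: rr => {r} [|r s _ [r' rr' Hr] _ [s' rs' Hs]|c r _ [r' rr' Hr]|r w rr [r' rr' Hr]].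
- by exists (fun x => 0 *: x); [exact/RightScale/RightId | move=> x; rewrite scale0r addr0].
- exists (fun x => r' x + s' x); first exact: RightAdd.
  by move=> x; rewrite linearDr Hr Hs addrACA.
- exists (fun x => c *: r' x); first exact: RightScale.
  by move=> x; rewrite linearZr_LR Hr scalerDr.
exists (fun x => (op (r' x) w + -1 *: op (op (r x) u) w) + op (r x) (op u w)).
  apply: RightAdd; last exact: RightMul.
  by apply: RightAdd; [exact: RightMul | apply: RightScale; do 2!apply: RightMul].
move=> x; rewrite novikov_swap Hr linearDl scaleN1r !addrA //.
Qed.

Definition generates (v x : N) : Prop := exists2 r, right_op r & r v = x.

Lemma generates_right_op v x r : right_op r -> generates v x -> generates v (r x).
Proof. by move=> rr [s rs <-]; exists (fun y => r (s y)); first exact: right_op_comp. Qed.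

Lemma generatesD v x y : generates v x -> generates v y -> generates v (x + y).
Proof. by move=> [r rr <-] [s rs <-]; exists (fun z => r z + s z); first exact: RightAdd. Qed.

Lemma generatesZ v c x : generates v x -> generates v (c *: x).
Proof. exact: (generates_right_op (RightScale c RightId)). Qed.

Lemma generates_mul v x w : generates v x -> generates v (op x w).
Proof. exact: (generates_right_op (RightMul w RightId)). Qed.

Lemma generates_refl v : generates v v.
Proof. by exists (fun x => x); first exact: RightId. Qed.

(** For [r] in [R], [u o (r v) = r (u o v) + r' v = r' v], so [R v] is a left ideal; it is a right
    ideal by construction. *)
Lemma generates_all v : v != 0 -> (forall u, op u v = 0) -> forall x, generates v x.
Proof.
move=> v0 uv; apply: simple_ideal.
- by rewrite -(scale0r v); apply/generatesZ/generates_refl.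
- exact: generatesD.
- exact: generatesZ.
- move=> u _ [r rr <-]; have [r' rr' ->] := right_op_commutator u rr.
  by exists r'; rewrite // uv right_op0 // add0r.
- by move=> u x; apply: generates_mul.
by exists v; last exact: generates_refl.
Qed.

(** * The case [R e = N]: a commutative differential algebra structure on [N] *)

Section Generator.
Variables (e : N) (b : F).
Hypothesis charF0 : [pchar F] =i pred0.
Hypothesis e_right : forall u, op u e = b *: u.
Hypothesis e_gen : forall x, generates e x.
Hypothesis e_lf : forall x, exists s, kill (op e) s x = 0.

(** A copy of [N], to carry the commutative product transported from [R] along [r |-> r e]. *)
Definition novikov_ring : Type := N.
HB.instance Definition _ := GRing.Lmodule.on novikov_ring.

Let rep (x : N) : N -> N := s2val (cid2 (e_gen x)).
Let rep_right x : right_op (rep x).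
Proof. exact: s2valP (cid2 (e_gen x)). Qed.
Let rep_e x : rep x e = x.
Proof. exact: s2valP' (cid2 (e_gen x)). Qed.

(** As [R] is commutative and [e] generates [N], an element of [R] is determined by its value at
    [e]. *)
Let right_op_eq r s y : right_op r -> right_op s -> r e = s e -> r y = s y.
Proof.
by move=> rr rs rse; have [q rq <-] := e_gen y; rewrite !(right_opC _ _ rq) // rse.
Qed.

Definition novikov_mul (x y : novikov_ring) : novikov_ring := rep y x.

Fact novikov_mulC : commutative novikov_mul.
Proof.
by move=> x y; rewrite /novikov_mul -{1}(rep_e x) -{2}(rep_e y) right_opC.
Qed.

Fact novikov_mulA : associative novikov_mul.
Proof.
move=> x y z; rewrite /novikov_mul.
by apply: (right_op_eq _ (rep_right _) (right_op_comp (rep_right z) (rep_right y))); rewrite !rep_e.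
Qed.

Fact novikov_mul1 : left_id (e : novikov_ring) novikov_mul.
Proof. by move=> x; exact: rep_e. Qed.

Fact novikov_mulDl : left_distributive novikov_mul +%R.
Proof. by move=> x y z; exact: right_opD. Qed.

Fact novikov_one_neq0 : (e : novikov_ring) != 0.
Proof.
have [_ [u [v]]] := simple_op; apply: contraNneq => e0.
have [r rr <-] := e_gen u.
by rewrite [e]e0 right_op0 // linear0l.
Qed.

HB.instance Definition _ := GRing.Zmodule_isComNzRing.Build novikov_ring
  novikov_mulA novikov_mulC novikov_mul1 novikov_mulDl novikov_one_neq0.

Fact novikov_scaleAl (a : F) (x y : novikov_ring) : a *: (x * y) = (a *: x) * y.
Proof. by rewrite /GRing.mul /= /novikov_mul right_opZ. Qed.
HB.instance Definition _ := GRing.Lmodule_isLalgebra.Build F novikov_ring novikov_scaleAl.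
HB.instance Definition _ := GRing.Lalgebra_isComAlgebra.Build F novikov_ring.

Definition novikov_der (x : novikov_ring) : novikov_ring := op e x - b *: x.

Fact novikov_der_linear : linear novikov_der.
Proof.
move=> c x y; rewrite /novikov_der linearPr !scalerDr scalerN opprD addrACA.
by rewrite !scalerA mulrC.
Qed.
HB.instance Definition _ := GRing.isLinear.Build F novikov_ring novikov_ring *:%R
  novikov_der novikov_der_linear.

(** Both [R_y] and multiplication by [e o y] lie in [R], and both take the value [e o y] at [e]. *)
Fact op_novikov_mul (x y : novikov_ring) : op x y = x * (op e y : novikov_ring).
Proof.
exact: (right_op_eq x (RightMul y RightId) (rep_right (op e y)) (esym (rep_e _))).
Qed.

(** The commutator [r'] of [L_e] with multiplication by [y] lies in [R], and
    [r' e = e o y - b y = d y] because [e o e = b e]; so [r'] is multiplication by [d y]. An ideal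
    stable under [d] is stable under [L_e], hence is a Novikov ideal, as [u o x = u * (e o x)]. *)
Fact novikov_der_simple : differentially_simple novikov_der.
Proof.
split=> [x y|I I0 ID IM Id ex].
  have [r' rr' Hr] := right_op_commutator e (rep_right y).
  have r'E z : r' z = rep (novikov_der y) z.
    apply: right_op_eq => //; rewrite rep_e /novikov_der -{1}(rep_e y) Hr.
    by rewrite e_right right_opZ // rep_e addrC addKr.
  change (op e (rep y x) - b *: rep y x = rep y (novikov_der x) + rep (novikov_der y) x).
  rewrite Hr r'E addrAC; congr (_ + _).
  have ry := rep_right y.
  rewrite /novikov_der -[in RHS]scaleNr (right_opD _ _ ry) (right_opZ _ _ ry).
  by rewrite scaleNr.
have IZ c (x : novikov_ring) : I x -> I (c *: x).
  by move=> Ix; rewrite -[x]mul1r scalerAl; apply: IM.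
have Iop (x : novikov_ring) : I x -> I (op e x).
  by move=> Ix; rewrite -[op e x](subrK (b *: x)); apply: ID (Id _ Ix) (IZ _ _ Ix).
apply: (simple_ideal (I := I)) => //.
- by move=> u x Ix; rewrite op_novikov_mul; apply/IM/Iop.
by move=> u x Ix; rewrite op_novikov_mul mulrC; apply: IM.
Qed.

Lemma generator_classification : isomorphic_to_some_algA op.
Proof.
apply: (@differentially_simple_classification F novikov_ring novikov_der b op) => //.
- exact: novikov_der_simple.
(* The eigenvalues of [d = L_e - b] are those of [L_e] shifted by [-b]. *)
- move=> x; have [s ks] := e_lf x; exists [seq a - b | a <- s].
  rewrite -{}ks; elim: s x => //= a s IHs x; rewrite IHs; congr (kill _ _ _).
  by rewrite /novikov_der scalerBl opprB addrA subrK.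
by move=> x y; rewrite op_novikov_mul /novikov_der subrK.
Qed.

End Generator.

(** * The case [b != 0]: the kernel of [L_e] *)

Section NonGenerator.
Variables (e : N) (b : F).
Hypothesis charF0 : [pchar F] =i pred0.
Hypothesis b_neq0 : b != 0.
Hypothesis e_right : forall u, op u e = b *: u.
Hypothesis e_lf : forall x, exists s, kill (op e) s x = 0.

Let op_e_mul x y : op e (op x y) = op (op e x) y + op x (op e y) - b *: op x y.
Proof. by rewrite novikov_swap e_right linearZl_LR addrAC. Qed.

(** Since [(L_e - (a - b)) (w o y) = (L_e w) o y + w o ((L_e - a) y)], a double induction applies,
    on the nilpotency order at [w] and on the list killing [y]. *)
Lemma spectrum_mul (Q P : F -> Prop) n w y :
  (forall a, Q a -> P (a - b)) -> iter n (op e) w = 0 ->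
  spectrum_in (op e) Q y -> spectrum_in (op e) P (op w y).
Proof.
move=> QP; elim: n w y => [|n IHn] w y.
  by move=> /= -> _; rewrite linear0l; exact: spectrum_in0.
rewrite iterSr => Tw [s]; elim: s y => [|a s IHs] y Qs ky.
  by rewrite [y]ky linear0r; exact: spectrum_in0.
have [s' Ps' ks'] : spectrum_in (op e) P (op (op e w) y + op w (op e y - a *: y)).
  apply: spectrum_inD; first by apply: (IHn _ _ Tw); exists (a :: s).
  by apply: IHs => // c cs; apply: Qs; rewrite inE cs orbT.
exists (a - b :: s') => [c|].
  by rewrite inE => /orP[/eqP->|/Ps' //]; apply: QP; apply: Qs; rewrite mem_head.
rewrite -{}ks' /=; congr (kill _ _ _).
rewrite op_e_mul linearBr linearZr_LR scalerBl opprB addrA.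
by rewrite [_ - _ + _ - _]addrAC addrAC subrK addrA.
Qed.

(* The ideal generated by N o ker L_e. Closing it only under left multiplication
   by generalised kernel vectors of L_e makes its L_e-eigenvalues visible;
   [kernel_ideal_left] shows that it is nevertheless a left ideal. *)
Inductive kernel_ideal : N -> Prop :=
| KernelMul u v : op e v = 0 -> kernel_ideal (op u v)
| KernelAdd x y : kernel_ideal x -> kernel_ideal y -> kernel_ideal (x + y)
| KernelScale c x : kernel_ideal x -> kernel_ideal (c *: x)
| KernelLeft n w x : iter n (op e) w = 0 -> kernel_ideal x -> kernel_ideal (op w x).

Let range_kernel z v : op e v = 0 -> op (op e z) v = 0.
Proof. by move=> ev; rewrite op_rcomm ev linear0l. Qed.

Let fitting x : exists z n, iter n (op e) (x - op e z) = 0.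
Proof. by have [s /fitting_decomposition] := e_lf x. Qed.

Lemma kernel_ideal_left u x : kernel_ideal x -> kernel_ideal (op u x).
Proof.
move=> Sx; elim: Sx u => {x} [u v ev|x y _ IHx _ IHy|c x _ IHx|n w x Tw Sx IHx] x'.
- have [z [n Tz]] := fitting x'.
  rewrite -[x'](subrK (op e z)) linearDl; apply: KernelAdd.
    exact/(KernelLeft Tz)/KernelMul.
  rewrite novikov_swap (range_kernel z ev) linear0r addr0 -scaleN1r.
  by apply: KernelAdd; [exact: KernelMul | exact/KernelScale/KernelMul].
- by rewrite linearDr; apply: KernelAdd.
- by rewrite linearZr_LR; apply: KernelScale.
rewrite novikov_swap -scaleN1r; apply: KernelAdd; last exact: KernelLeft Tw (IHx _).
by apply: KernelAdd; [exact: IHx | exact/KernelScale/IHx].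
Qed.

Lemma kernel_ideal_right u x : kernel_ideal x -> kernel_ideal (op x u).
Proof.
elim=> {x} [w v ev|x y _ IHx _ IHy|c x _ IHx|n w x Tw Sx IHx].
- by rewrite op_rcomm; apply: KernelMul.
- by rewrite linearDl; apply: KernelAdd.
- by rewrite linearZl_LR; apply: KernelScale.
by rewrite op_rcomm; apply: kernel_ideal_left.
Qed.

(** In [u o v] only the generalised kernel part of [u] contributes, so the only possible eigenvalue
    is [-b]; each further left multiplication subtracts [b]. *)
Lemma kernel_ideal_spectrum x : kernel_ideal x ->
  spectrum_in (op e) (fun a => exists k, a = - (b *+ k.+1)) x.
Proof.
elim=> {x} [u v ev|x y _ IHx _ IHy|c x _ IHx|n w x Tw Sx IHx].
- have [z [n Tz]] := fitting u.
  rewrite -[u](subrK (op e z)) linearDl (range_kernel z ev) addr0.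
  apply: (spectrum_mul (Q := fun a => a = 0) _ Tz) => [a ->|].
    by exists 0%N; rewrite sub0r.
  by exists [:: 0] => [a|]; [rewrite inE => /eqP | rewrite /= scale0r subr0].
- exact: spectrum_inD.
- exact: spectrum_inZ.
apply: (spectrum_mul _ Tw IHx) => a [k ->].
by exists k.+1; rewrite [in RHS]mulrS opprD addrC.
Qed.

Let natb_neq0 k : b *+ k.+1 != 0.
Proof.
rewrite -mulr_natl mulf_neq0 //; have /pcharf0P -> := charF0; exact: isT.
Qed.

(** Otherwise the ideal is all of [N] and contains [e], whose eigenvalue [b] is not of the form
    [-(k + 1) b]. Then [e = 0], contrary to [b != 0]. *)
Lemma kernel_right_annihilates v : op e v = 0 -> forall u, op u v = 0.
Proof.
move=> ev u; apply/eqP; apply: contraT => uv0.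
have [_ [p [q pq]]] := simple_op.
have Se : kernel_ideal e.
  apply: simple_ideal.
  - by rewrite -(scale0r (op u v)); apply/KernelScale/KernelMul.
  - exact: KernelAdd.
  - exact: KernelScale.
  - exact: kernel_ideal_left.
  - exact: kernel_ideal_right.
  by exists (op u v) => //; exact: KernelMul.
have e0 : e = 0.
  apply: (spectrum_in_eigen (kernel_ideal_spectrum Se) (e_right e)) => -[k bk].
  by have := natb_neq0 k.+1; rewrite mulrS {1}bk addNr eqxx.
have : b *: p == 0 by rewrite -e_right e0 linear0r.
rewrite scaler_eq0 (negbTE b_neq0) => /eqP p0.
by rewrite p0 linear0l eqxx in pq.
Qed.

Hypothesis e_nongen : ~ forall x, generates e x.

Let range_generates x y : op e y = x -> generates e x.
Proof. by move=> <-; apply: generates_mul; exact: generates_refl. Qed.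

(** If [L_e] were injective, it would be onto by local finiteness; but its values [e o y = R_y e]
    lie in [R e]. *)
Lemma kernel_nontrivial : exists2 v, v != 0 & op e v = 0.
Proof.
have [//|no_v] := pselect (exists2 v, v != 0 & op e v = 0).
case: e_nongen => x; have [s kx] := e_lf x.
have [|y] := @injective_range _ _ (op e) s x _ kx; last exact: range_generates.
by move=> y ey; apply/eqP; apply: contraT => y0; case: no_v; exists y.
Qed.

(** * A nonzero kernel vector [v] of [L_e] generates [N], and [L_v] is locally nilpotent *)

Section Kernel.
Variable v : N.
Hypotheses (v_neq0 : v != 0) (ev : op e v = 0).

Let uv u : op u v = 0.
Proof. exact: kernel_right_annihilates. Qed.

Let v_gen x : generates v x.
Proof. exact: generates_all. Qed.

Let op_e_v x : op e (op v x) = op v (op e x) - b *: op v x.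
Proof. by rewrite novikov_swap ev linear0l sub0r e_right linearZl_LR addrC. Qed.

Inductive orbit_ideal (y : N) : N -> Prop :=
| OrbitIter m : orbit_ideal y (iter m (op v) y)
| OrbitAdd x x' : orbit_ideal y x -> orbit_ideal y x' -> orbit_ideal y (x + x')
| OrbitScale c x : orbit_ideal y x -> orbit_ideal y (c *: x)
| OrbitRight x w : orbit_ideal y x -> orbit_ideal y (op x w).

(** As [N o v = 0], [[L_v, R_w] = R_(v o w)], so [L_v] preserves the [R]-span of the [L_v^m y].
    Every [u] is [r v] with [r] in [R], and [(r v) o x = r (v o x)]; hence the span is a left
    ideal. *)
Lemma orbit_ideal_all y : y != 0 -> forall x, orbit_ideal y x.
Proof.
move=> y0.
have Xv x : orbit_ideal y x -> orbit_ideal y (op v x).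
  elim=> {x} [m|x x' _ IHx _ IHx'|c x _ IHx|x w Xx IHx].
  - exact: (OrbitIter y m.+1).
  - by rewrite linearDr; apply: OrbitAdd.
  - by rewrite linearZr_LR; apply: OrbitScale.
  by rewrite novikov_swap uv linear0l subr0; apply: OrbitAdd; apply: OrbitRight.
apply: simple_ideal.
- by rewrite -(scale0r y); apply/OrbitScale/(OrbitIter y 0).
- exact: OrbitAdd.
- exact: OrbitScale.
- move=> u x Xx; have [r rr <-] := v_gen u; rewrite -right_op_mul //.
  elim: rr => {r} [|r s _ IHr _ IHs|c r _ IHr|r w _ IHr]; first exact: Xv.
  + exact: OrbitAdd.
  + exact: OrbitScale.
  exact: OrbitRight.
- by move=> u x; apply: OrbitRight.
by exists y => //; exact: (OrbitIter y 0).
Qed.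

(** Otherwise each [L_v^m y] has eigenvalue [a - m b != 0], so it lies in the range of [L_e], inside
    [R e]. These vectors span [N] over [R], whence [R e = N]. *)
Lemma eigenvalue_natmul y a : y != 0 -> op e y = a *: y -> exists k, a = b *+ k.
Proof.
move=> y0 Ty; have [//|no_k] := pselect (exists k, a = b *+ k).
case: e_nongen => x; elim: (orbit_ideal_all y0 x) => {x} [m|x x' _ Gx _ Gx'|c x _ Gx|x w _ Gx].
- have Tm : op e (iter m (op v) y) = (a - b *+ m) *: iter m (op v) y.
    elim: m => [|m IHm]; first by rewrite subr0.
    by rewrite iterS op_e_v IHm linearZr_LR -scalerBl mulrSr opprD addrA.
  have am : a - b *+ m != 0 by rewrite subr_eq0; apply/eqP => am; case: no_k; exists m.
  apply: (@range_generates _ ((a - b *+ m)^-1 *: iter m (op v) y)).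
  by rewrite linearZr_LR Tm scalerA mulVf // scale1r.
- exact: generatesD.
- exact: generatesZ.
exact: generates_mul.
Qed.

(** Since [L_v] lowers eigenvalues by [b], for large [n] no candidate eigenvalue at [L_v^n x] is a
    natural multiple of [b], and [eigenvalue_natmul] forces [L_v^n x = 0]. *)
Lemma kernel_locally_nilpotent x : exists n, iter n (op v) x = 0.
Proof.
have [s ks] := e_lf x.
have shift n : kill (op e) [seq a - b *+ n | a <- s] (iter n (op v) x) = 0.
  elim: n => [|n IHn].
    rewrite -[RHS]ks; congr (kill _ _ _); rewrite -[RHS]map_id.
    by apply: eq_map => a; rewrite subr0.
  have step r z : kill (op e) [seq a - b | a <- r] (op v z) = op v (kill (op e) r z).
    elim: r z => //= a r IHr z; rewrite -IHr; congr (kill _ _ _).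
    by rewrite op_e_v linearBr linearZr_LR scalerBl opprB addrA subrK.
  rewrite iterS -[RHS](linear0r op v) -{}IHn -step; congr (kill _ _ _).
  by rewrite -map_comp; apply: eq_map => a /=; rewrite mulrSr opprD addrA.
have [n Hn] : exists n, forall a, a \in s -> forall k, a - b *+ n != b *+ k.
  suff [n Hn] : exists n, forall m a, (n <= m)%N -> a \in s -> forall k, a - b *+ m != b *+ k.
    by exists n => a; exact: Hn.
  elim: {ks shift} s => [|a s [n Hn]]; first by exists 0%N.
  (* If [a] is not a natural multiple of [b], neither is any [a - m b]; if [a = l b], every [m > l]
     works. *)
  have [[l al]|no_l] := pselect (exists l, a = b *+ l); last first.
    exists n => m c nm; rewrite inE => /orP[/eqP->|/Hn]; last exact.
    move=> k; apply/eqP => /(congr1 (+%R^~ (b *+ m))); rewrite subrK -mulrnDr => ak.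
    by case: no_l; exists (k + m)%N.
  exists (maxn n l.+1) => m c; rewrite geq_max => /andP[nm lm].
  rewrite inE => /orP[/eqP->|/(Hn _ _ nm)//] k.
  apply/eqP => /(congr1 (+%R^~ (b *+ m))); rewrite subrK -mulrnDr al => /eqP.
  have lt : (l < k + m)%N by rewrite (leq_trans lm) // leq_addl.
  rewrite -(subnKC (ltnW lt)) mulrnDr -subr_eq0 opprD addrA subrr sub0r oppr_eq0.
  by rewrite -subn_gt0 in lt; rewrite -(prednK lt); apply/negP; exact: natb_neq0.
exists n; apply/eqP; apply: contraT => x0.
have [a] := kill_eigenvector (shift n) x0.
move=> /mapP[c cs ->] [y y0 /(eigenvalue_natmul y0)[k /eqP]].
by rewrite (negbTE (Hn c cs k)).
Qed.

Lemma kernel_classification : isomorphic_to_some_algA op.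
Proof.
apply: (@generator_classification v 0) => // [u|x]; first by rewrite uv scale0r.
have [n nx] := kernel_locally_nilpotent x.
by exists (nseq n 0); rewrite kill_nseq0.
Qed.

End Kernel.
End NonGenerator.
End RightMultiplications.

(** * Case distinction on whether [R e] is all of [N] *)

Theorem theorem3p4 (F : closedFieldType) (charF0 : [pchar F] =i pred0)
    (N : lmodType F) (op : {bilinear N -> N -> N})
    (novikov_op : novikov op) (infN : infinite_dimensional N)
    (simple_op : simple_algebra op)
    (e : N)
    (e_left_loc_fin : locally_finite (fun v => op e v))
    (e_right_const : exists b : F, forall v : N, op v e = b *: v)
    (e_left_surj : (forall v : N, op v e = 0) ->
                   forall w : N, exists v : N, op e v = w) :
  exists (Delta : zmodClosed F) (F1 : fieldType) (iota : {rmorphism F -> F1})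
         (f : subgroup Delta -> subgroup Delta -> F1) (J : {pred nat}) (xi : F),
    [/\ two_cycle f, symmetric_cycle f,
        J =i pred1 0%N \/ J =i predT
      & isomorphic_to_algA iota f J xi op].
Proof.
have e_lf := locally_finite_kill (T := op e) e_left_loc_fin.
have [b e_right] := e_right_const.
have [e_gen|e_nongen] := pselect (forall x, generates op e x).
  exact: (generator_classification novikov_op simple_op charF0 e_right e_gen e_lf).
have [b0|b0] := eqVneq b 0.
  (* For [b = 0], [N o e = 0] and the surjectivity of [L_e] gives [e != 0], so [R e = N] after
     all. *)
  case: e_nongen; have ue u : op u e = 0 by rewrite e_right b0 scale0r.
  apply: generates_all => //; apply: contraPneq (proj2 simple_op) => e0 [u [w /eqP[]]].
  by have [x <-] := e_left_surj ue u; rewrite e0 !linear0l.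
have [v v0 ev] := kernel_nontrivial e_lf e_nongen.
exact: (kernel_classification novikov_op simple_op charF0 b0 e_right e_lf e_nongen v0 ev).
Qed.
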